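(* Let $(\mathfrak{g}, [~,~]_\mathfrak{g})$ be any Leibniz algebra. Then there is a compatible post-Leibniz algebra structure on $\mathfrak{g}$ if and only if there exists a Leibniz $\mathfrak{g}$-representation $\mathfrak{h}$ and an invertible $1$-weighted relative Rota-Baxter operator $T: \mathfrak{h} \rightarrow \mathfrak{g}$.
   Context: All vector spaces and (multi)linear maps are over a field $\mathbf{k}$ of characteristic $0$. A (left) Leibniz algebra is a vector space $\mathfrak{g}$ with a bilinear bracket $[~,~]_\mathfrak{g}$ satisfying $[x,[y,z]_\mathfrak{g}]_\mathfrak{g} = [[x,y]_\mathfrak{g},z]_\mathfrak{g} + [y,[x,z]_\mathfrak{g}]_\mathfrak{g}$ for all $x,y,z$. A representation of $\mathfrak{g}$ is a vector space $V$ with bilinear maps $\rho^L : \mathfrak{g}\otimes V \to V$, $\rho^R : V \otimes \mathfrak{g} \to V$ such that for $x,y\in\mathfrak{g}$, $v \in V$: $\rho^L(x,\rho^L(y,v)) = \rho^L([x,y]_\mathfrak{g},v) + \rho^L(y,\rho^L(x,v))$; $\rho^L(x,\rho^R(v,y)) = \rho^R(\rho^L(x,v),y) + \rho^R(v,[x,y]_\mathfrak{g})$; $\rho^R(v,[x,y]_\mathfrak{g}) = \rho^R(\rho^R(v,x),y) + \rho^L(x,\rho^R(v,y))$. A Leibniz algebra $\mathfrak{h}$ is a Leibniz $\mathfrak{g}$-representation if it has maps $\rho^L,\rho^R$ making it a representation of $\mathfrak{g}$ and, for $u,v\in\mathfrak{h}$, $x\in\mathfrak{g}$: $[u,\rho^R(v,x)]_\mathfrak{h}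 = \rho^R([u,v]_\mathfrak{h},x) + [v,\rho^R(u,x)]_\mathfrak{h}$; $[u,\rho^L(x,v)]_\mathfrak{h} = [\rho^R(u,x),v]_\mathfrak{h} + \rho^L(x,[u,v]_\mathfrak{h})$; $\rho^L(x,[u,v]_\mathfrak{h}) = [\rho^L(x,u),v]_\mathfrak{h} + [u,\rho^L(x,v)]_\mathfrak{h}$. A linear map $T:\mathfrak{h}\to\mathfrak{g}$ is a $1$-weighted relative Rota-Baxter operator if $[Tu,Tv]_\mathfrak{g} = T(\rho^L(Tu,v)+\rho^R(u,Tv)+[u,v]_\mathfrak{h})$ for all $u,v\in\mathfrak{h}$. A post-Leibniz algebra is a vector space $\mathfrak{a}$ with three bilinear operations $\triangleleft,\triangleright,[~,~]_\mathfrak{a}:\mathfrak{a}\otimes\mathfrak{a}\to\mathfrak{a}$ satisfying for $u,v,w\in\mathfrak{a}$, with $[u,v]_\star = u\triangleleft v+u\triangleright v+[u,v]_\mathfrak{a}$: (1) $u \triangleleft [v , w]_\star = (u \triangleleft v) \triangleleft w + v \triangleright (u \triangleleft w)$; (2) $u \triangleright (v \triangleleft w) = (u \triangleright v) \triangleleft w + v \triangleleft [u , w]_\star$; (3) $u \triangleright (v \triangleright w) = [u , v]_\star \triangleright w + v \triangleright (u \triangleright w)$; (4) $u \triangleright [v,w]_\mathfrak{a} = [u \triangleright v, w]_\mathfrak{a} + [ v, u \triangleright w]_\mathfrak{a}$; (5) $[u, v \triangleright w]_\mathfrak{a} = [ u \triangleleft v, w]_\mathfrak{a} + v \triangleright [u,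 w]_\mathfrak{a}$; (6) $[u, v \triangleleft w]_\mathfrak{a} = [u,v]_\mathfrak{a} \triangleleft w + [v, u \triangleleft w]_\mathfrak{a}$; (7) $[u, [v,w]_\mathfrak{a}]_\mathfrak{a} = [[u,v]_\mathfrak{a}, w]_\mathfrak{a} + [v, [u, w]_\mathfrak{a}]_\mathfrak{a}$. A compatible post-Leibniz algebra structure on a Leibniz algebra $(\mathfrak{g},[~,~]_\mathfrak{g})$ is a post-Leibniz algebra $(\mathfrak{g},\triangleleft,\triangleright,[~,~]'_\mathfrak{g})$ on the same vector space such that $[x,y]_\mathfrak{g} = x\triangleleft y + x\triangleright y+[x,y]'_\mathfrak{g}$ for all $x,y\in\mathfrak{g}$. *)

(* Defs.v *)
From HB Require Import structures.
From mathcomp Require Import all_boot all_order all_algebra.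
Set Implicit Arguments.
Unset Strict Implicit.
Unset Printing Implicit Defensive.
Import GRing.Theory.
Local Open Scope ring_scope.

Definition left_leibniz (K : fieldType) (g : lmodType K)
    (br : {bilinear g -> g -> g}) : Prop :=
  forall x y z : g, br x (br y z) = br (br x y) z + br y (br x z).

Record leibniz_rep (K : fieldType) (g : lmodType K)
    (br : {bilinear g -> g -> g}) (V : lmodType K)
    (rhoL : {bilinear g -> V -> V}) (rhoR : {bilinear V -> g -> V}) : Prop :=
  LeibnizRep {
    lrep_LL : forall (x y : g) (v : V),
      rhoL x (rhoL y v) = rhoL (br x y) v + rhoL y (rhoL x v);
    lrep_LR : forall (x y : g) (v : V),
      rhoL x (rhoR v y) = rhoR (rhoL x v) y + rhoR v (br x y);
    lrep_RR : forall (x y : g) (v : V),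
      rhoR v (br x y) = rhoR (rhoR v x) y + rhoL x (rhoR v y)
  }.

(* The underlying Leibniz algebra of the Leibniz g-representation is (h, brh). *)
Record leibniz_alg_rep (K : fieldType) (g : lmodType K)
    (br : {bilinear g -> g -> g}) (h : lmodType K)
    (brh : {bilinear h -> h -> h})
    (rhoL : {bilinear g -> h -> h}) (rhoR : {bilinear h -> g -> h}) : Prop :=
  LeibnizAlgRep {
    larep_leibniz : left_leibniz brh;
    larep_rep : leibniz_rep br rhoL rhoR;
    larep_R : forall (u v : h) (x : g),
      brh u (rhoR v x) = rhoR (brh u v) x + brh v (rhoR u x);
    larep_RL : forall (u v : h) (x : g),
      brh u (rhoL x v) = brh (rhoR u x) v + rhoL x (brh u v);
    larep_L : forall (u v : h) (x : g),
      rhoL x (brh u v) = brh (rhoL x u) v + brh u (rhoL x v)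
  }.

Definition rel_rota_baxter1 (K : fieldType) (g : lmodType K)
    (br : {bilinear g -> g -> g}) (h : lmodType K)
    (brh : {bilinear h -> h -> h})
    (rhoL : {bilinear g -> h -> h}) (rhoR : {bilinear h -> g -> h})
    (T : {linear h -> g}) : Prop :=
  forall u v : h,
    br (T u) (T v) = T (rhoL (T u) v + rhoR u (T v) + brh u v).

(* tl, tr and br stand for the operations written as left triangle,
   right triangle and bracket. *)
Definition post_star (K : fieldType) (a : lmodType K)
    (tl tr br : {bilinear a -> a -> a}) (u v : a) : a :=
  tl u v + tr u v + br u v.

Record post_leibniz (K : fieldType) (a : lmodType K)
    (tl tr br : {bilinear a -> a -> a}) : Prop :=
  PostLeibniz {
    post_l_star : forall u v w : a,
      tl u (post_star tl tr br v w) = tl (tl u v) w + tr v (tl u w);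
    post_r_l : forall u v w : a,
      tr u (tl v w) = tl (tr u v) w + tl v (post_star tl tr br u w);
    post_r_r : forall u v w : a,
      tr u (tr v w) = tr (post_star tl tr br u v) w + tr v (tr u w);
    post_r_br : forall u v w : a,
      tr u (br v w) = br (tr u v) w + br v (tr u w);
    post_br_r : forall u v w : a,
      br u (tr v w) = br (tl u v) w + tr v (br u w);
    post_br_l : forall u v w : a,
      br u (tl v w) = tl (br u v) w + br v (tl u w);
    post_br_br : left_leibniz br
  }.

Definition compatible_post_leibniz (K : fieldType) (g : lmodType K)
    (brg tl tr br : {bilinear g -> g -> g}) : Prop :=
  post_leibniz tl tr br /\ forall x y : g, brg x y = post_star tl tr br x y.

(* Main.v *)
Require Import Defs.
From HB Require Import structures.
From mathcomp Require Import all_boot all_order all_algebra.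
Import GRing.Theory.
Local Open Scope ring_scope.

(** A post-Leibniz algebra and an invertible weight-one Rota-Baxter operator are
    the same data read through an isomorphism.

    Once the total operation u * v = tl u v + tr u v + br u v is the given
    bracket brg, the post-Leibniz axioms are those of a Leibniz representation:
    [post_r_r], [post_r_l] and [post_l_star] are the three axioms for the left
    action tr and the right action tl of (g, brg) on the space g; [post_br_l],
    [post_br_r] and [post_r_br] are the compatibilities of these actions with
    br; and [post_br_br] says that br is a Leibniz bracket.  The Rota-Baxter
    identity for the identity map is then the splitting of brg into its three
    parts ([post_leibniz_rep], [id_rota_baxter1]).

    Conversely, an invertible Rota-Baxter operator T : h -> g transports the
    actions and the bracket of h to operations on g: the right triangle, for
    instance, becomes T (rhoL x (T^-1 y)), in which only the arguments lying in
    h have to be moved.  The Rota-Baxter identity at T^-1 x and T^-1 y says that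
    these operations add up to brg ([rota_baxter_star]), and each post-Leibniz
    axiom is the T-image of one axiom of Leibniz representations
    ([rota_baxter_compatible]). *)

Section BilinearTransport.

Context (K : fieldType) (U V W U' V' W' : lmodType K).
Variables (f : {bilinear U -> V -> W}) (A : {linear U' -> U})
  (B : {linear V' -> V}) (C : {linear W -> W'}).

Definition bilinear_comp (x : U') (y : V') : W' := C (f (A x) (B y)).

Lemma bilinear_comp_bilinear :
  bilinear_for *:%R *:%R (bilinear_comp : U' -> V' -> W').
Proof.
split=> [y | x] a u v /=; rewrite /bilinear_comp.
  by rewrite (linearP A) linearPl (linearP C).
by rewrite (linearP B) linearPr (linearP C).
Qed.

HB.instance Definition _ :=
  bilinear_isBilinear.Build K U' V' W' *:%R *:%R bilinear_comp
    bilinear_comp_bilinear.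

End BilinearTransport.

Arguments bilinear_comp {K U V W U' V' W'} f A B C.

Section PostLeibnizToRotaBaxter.

Context (K : fieldType) (g : lmodType K).
Variables brg tl tr br : {bilinear g -> g -> g}.
Hypothesis compat : compatible_post_leibniz brg tl tr br.

Lemma post_leibniz_rep : leibniz_alg_rep brg br tr tl.
Proof.
case: compat => -[l_star r_l r_r r_br br_r br_l br_br] brgE.
split=> //; split=> x y v; rewrite brgE.
- exact: r_r.
- exact: r_l.
- exact: l_star.
Qed.

Lemma id_rota_baxter1 : rel_rota_baxter1 brg br tr tl (idfun : {linear g -> g}).
Proof.
by case: compat => _ brgE u v /=; rewrite brgE /post_star [tl u v + _]addrC.
Qed.

End PostLeibnizToRotaBaxter.

Section RotaBaxterToPostLeibniz.

Context (K : fieldType) (g h : lmodType K).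
Variables (brg : {bilinear g -> g -> g}) (brh : {bilinear h -> h -> h}).
Variables (rhoL : {bilinear g -> h -> h}) (rhoR : {bilinear h -> g -> h}).
Variables (T : {linear h -> g}) (T' : {linear g -> h}).
Hypotheses (TK : cancel T T') (T'K : cancel T' T).
Hypothesis rep : leibniz_alg_rep brg brh rhoL rhoR.
Hypothesis rbT : rel_rota_baxter1 brg brh rhoL rhoR T.

Let tl : {bilinear g -> g -> g} := bilinear_comp rhoR T' idfun T.
Let tr : {bilinear g -> g -> g} := bilinear_comp rhoL idfun T' T.
Let br : {bilinear g -> g -> g} := bilinear_comp brh T' T' T.

Let tlE x y : tl x y = T (rhoR (T' x) y). Proof. by []. Qed.
Let trE x y : tr x y = T (rhoL x (T' y)). Proof. by []. Qed.
Let brE x y : br x y = T (brh (T' x) (T' y)). Proof. by []. Qed.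

(** This is what eliminates the total operation from the post-Leibniz axioms,
    since the axioms of a representation only mention the bracket of g. *)
Lemma rota_baxter_star x y : brg x y = post_star tl tr br x y.
Proof.
rewrite -[in LHS](T'K x) -[in LHS](T'K y) rbT !T'K /post_star tlE trE brE.
by rewrite !linearD [T (rhoL _ _) + _]addrC.
Qed.

Lemma rota_baxter_compatible : compatible_post_leibniz brg tl tr br.
Proof.
split; last exact: rota_baxter_star.
case: rep => brh_leibniz [repLL repLR repRR] repR repRL repL.
(* TK cancels every T' o T between two nested operations, so that both sides
   of each axiom become the image under T of an identity in h. *)
split=> u v w; rewrite -?rota_baxter_star !(tlE, trE, brE) !TK -linearD.
- by rewrite repRR.
- by rewrite repLR.
- by rewrite repLL.
- by rewrite repL.
- by rewrite repRL.
- by rewrite repR.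
- by rewrite brh_leibniz.
Qed.

End RotaBaxterToPostLeibniz.

Theorem proposition6p5 (K : fieldType) (charK0 : [pchar K] =i pred0)
    (g : lmodType K) (brg : {bilinear g -> g -> g})
    (leibniz_g : left_leibniz brg) :
  (exists tl tr br : {bilinear g -> g -> g},
     compatible_post_leibniz brg tl tr br)
  <->
  (exists (h : lmodType K) (brh : {bilinear h -> h -> h})
          (rhoL : {bilinear g -> h -> h}) (rhoR : {bilinear h -> g -> h})
          (T : {linear h -> g}),
     [/\ leibniz_alg_rep brg brh rhoL rhoR,
         rel_rota_baxter1 brg brh rhoL rhoR T
       & bijective T]).
Proof.
split=> [[tl [tr [br compat]]] | [h [brh [rhoL [rhoR [T [rep rbT [T' TK T'K]]]]]]]].
  exists g, br, tr, tl, idfun; split; last by exists idfun.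
    exact: post_leibniz_rep compat.
  exact: id_rota_baxter1 compat.
pose linT' := GRing.isLinear.Build K g h *:%R T' (can2_linear TK T'K).
pose T'l : {linear g -> h} := HB.pack T' linT'.
have := @rota_baxter_compatible K g h brg brh rhoL rhoR T T'l TK T'K rep rbT.
by move=> compat; do 3!eexists; exact: compat.
Qed.
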